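(* Fix an integer $d\ge 1$ and a real number $p\in(1,\infty)$ such that $p\neq 2$. Then for every integer $n\ge 2d+1$ there exist a measurable set $E\subseteq\mathbb{R}^d$, an $n$-point configuration $P\subseteq\mathbb{R}^d$, and a sequence of positive numbers $(r_j)_j$ with $r_j\to\infty$, such that $E$ contains no $\ell^p$-isometric copy of $r_jP$ for any $j$, while the density $\mathrm{d}(E)$ exists and \[ \mathrm{d}(E)=1-\frac{1}{n-2d+2}. \]
   Context: For a measurable set $E\subseteq\mathbb{R}^d$, $|E|$ denotes its Lebesgue measure, and its density is \[ \mathrm{d}(E):=\lim_{R\to\infty}\frac{|E\cap[-R/2,R/2]^d|}{R^d}, \] provided the limit exists. For $x=(x_1,\ldots,x_d)\in\mathbb{R}^d$ write $\|x\|_p:=\big(\sum_{i=1}^d|x_i|^p\big)^{1/p}$. An $n$-point configuration is a set of exactly $n$ points. For a finite set $P\subseteq\mathbb{R}^d$ and $r\in(0,\infty)$, a set $Y\subseteq\mathbb{R}^d$ is an $\ell^p$-isometric copy of $rP$ if there exists a bijection $\phi\colon P\to Y$ such that $\|\phi(u)-\phi(v)\|_p=r\|u-v\|_p$ for all $u,v\in P$. ''$E$ contains an $\ell^p$-isometric copy of $rP$'' means that some such $Y$ satisfies $Y\subseteq E$. *)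

(* Defs.v *)
From HB Require Import structures.
From mathcomp Require Import all_boot all_order all_algebra.
From mathcomp Require Import all_classical all_reals all_analysis.

Set Implicit Arguments.
Unset Strict Implicit.
Unset Printing Implicit Defensive.
Import Order.TTheory GRing.Theory Num.Theory.
Import numFieldNormedType.Exports.

Local Open Scope classical_set_scope.
Local Open Scope ring_scope.

(* R^d; the library equips it with the product (i.e. Borel) sigma-algebra. *)
Notation pointR R d := (d.-tuple (measurableTypeR R)).

Section cons_measure.
Context (R : realType) (d : nat).
Local Open Scope ereal_scope.
Variable mu : {sigma_finite_measure set (pointR R d) -> \bar R}.

Definition cons_point (z : measurableTypeR R * pointR R d) : pointR R d.+1 :=
  [tuple of z.1 :: z.2].

Definition tail_point (x : pointR R d.+1) : pointR R d := [tuple of behead x].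

Lemma measurable_cons_point : measurable_fun setT cons_point.
Proof. exact: measurable_cons measurable_fst measurable_snd. Qed.

Definition cons_measure : set (pointR R d.+1) -> \bar R :=
  pushforward (@lebesgue_measure R \x mu) cons_point.

HB.instance Definition _ := Measure.copy cons_measure
  (measure_function_pushforward__canonical__measure_function_Measure
     (@lebesgue_measure R \x mu) measurable_cons_point).

Lemma cons_measureE (A : set (measurableTypeR R)) (B : set (pointR R d)) :
  measurable A -> measurable B ->
  cons_measure [set x | A (tnth x ord0) /\ B (tail_point x)] =
  lebesgue_measure A * mu B.
Proof.
move=> mA mB; rewrite -product_measure1E// /cons_measure /pushforward.
congr product_measure1; apply/seteqP; split => -[a t] /=;
  by rewrite tnth0 (_ : tail_point _ = t)//; exact/val_inj.
Qed.

Let cons_measure_sigma_finite : sigma_finite setT cons_measure.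
Proof.
have /sigma_finiteP[F [TF ndF Foo]] := sigma_finiteT (@lebesgue_measure R).
have /sigma_finiteP[G [TG ndG Goo]] := sigma_finiteT mu.
exists (fun k => [set x | F k (tnth x ord0) /\ G k (tail_point x)]).
  apply/esym/seteqP; split => // x _.
  have [i _ Fi] : (\bigcup_k F k) (tnth x ord0) by rewrite -TF.
  have [j _ Gj] : (\bigcup_k G k) (tail_point x) by rewrite -TG.
  exists (maxn i j) => //; split.
    by apply: (subsetPset _ _ (ndF _ _ (leq_maxl i j))).
  by apply: (subsetPset _ _ (ndG _ _ (leq_maxr i j))).
move=> k; have [mF Fk] := Foo k; have [mG Gk] := Goo k; split.
  apply: measurableI; rewrite -[X in measurable X]setTI.
    exact: (@measurable_tnth _ (measurableTypeR R) d.+1 ord0).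
  exact: (@measurable_behead _ (measurableTypeR R) d).
by rewrite cons_measureE// lte_mul_pinfty// ge0_fin_numE.
Qed.

HB.instance Definition _ :=
  Measure_isSigmaFinite.Build _ _ _ cons_measure cons_measure_sigma_finite.

End cons_measure.

(* The product Lebesgue measure on the Borel sets of R^d. *)
Fixpoint borel_lebesgue (R : realType) (d : nat) :
    {sigma_finite_measure set (pointR R d) -> \bar R} :=
  match d with
  | 0 => [the {sigma_finite_measure set (pointR R 0) -> \bar R} of
            dirac ([tuple] : pointR R 0)]
  | d'.+1 => [the {sigma_finite_measure set (pointR R d'.+1) -> \bar R} of
            cons_measure (borel_lebesgue R d')]
  end.

Lemma borel_lebesgue_box (R : realType) (d : nat)
    (A : 'I_d -> set (measurableTypeR R)) :
  (forall i, measurable (A i)) ->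
  borel_lebesgue R d [set x | forall i, A i (tnth x i)] =
  (\prod_(i < d) lebesgue_measure (A i))%E.
Proof.
elim: d A => [|d IH] A mA /=.
  rewrite big_ord0 diracE mem_set// => -[].
  by case.
rewrite big_ord_recl -(IH (fun i => A (lift ord0 i)))//.
rewrite -cons_measureE//; last first.
  rewrite (_ : [set _ | _] =
    \bigcap_(i in [set: 'I_d]) ((@tnth d _)^~ i @^-1` A (lift ord0 i))).
    apply: fin_bigcap_measurable => // i _.
    by rewrite -[X in measurable X]setTI; exact: measurable_tnth.
  by apply/seteqP; split => x /= h i; [move=> _; exact: h | exact: (h i I)].
have tnth_behead (x : pointR R d.+1) i :
    tnth (tail_point x) i = tnth x (lift ord0 i).
  by rewrite /tail_point [in RHS](tuple_eta x) tnthS.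
congr (cons_measure _); apply/seteqP; split => x /=.
  by move=> h; split => // i; rewrite tnth_behead.
move=> [h0 h1] i; case: (unliftP ord0 i) => [j|] -> //.
by rewrite -tnth_behead.
Qed.

(* |E|, for E in the Lebesgue sigma-algebra of R^d, i.e. the
   Caratheodory-measurable sets of the outer measure (borel_lebesgue R d)^*. *)
Definition lebesgue (R : realType) (d : nat) (E : set (pointR R d)) : \bar R :=
  @completed_measure_extension _ _ _ (borel_lebesgue R d) E.

Definition lebesgue_measurable (R : realType) (d : nat)
    (E : set (pointR R d)) : Prop :=
  ((borel_lebesgue R d)^*)%mu.-cara.-measurable E.

(* [-s/2, s/2]^d *)
Definition cube (R : realType) (d : nat) (s : R) : set (pointR R d) :=
  [set x | forall i : 'I_d, - (s / 2) <= (tnth x i : R) <= s / 2].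

Definition has_density (R : realType) (d : nat) (E : set (pointR R d))
    (delta : R) : Prop :=
  (lebesgue (E `&` cube s) * ((s ^+ d)^-1)%:E)%E @[s --> +oo] --> delta%:E.

Definition lp_norm (R : realType) (d : nat) (p : R) (x : pointR R d) : R :=
  (\sum_(i < d) `|tnth x i : R| `^ p) `^ p^-1.

Definition sub_point (R : realType) (d : nat) (x y : pointR R d) : pointR R d :=
  [tuple (tnth x i : R) - tnth y i | i < d].

Definition lp_copy (R : realType) (d : nat) (p r : R)
    (P Y : set (pointR R d)) : Prop :=
  exists2 phi : pointR R d -> pointR R d, set_bij P Y phi &
    forall u v, P u -> P v ->
      lp_norm p (sub_point (phi u) (phi v)) = r * lp_norm p (sub_point u v).

Definition contains_lp_copy (R : realType) (d : nat) (p r : R)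
    (P E : set (pointR R d)) : Prop :=
  exists2 Y : set (pointR R d), lp_copy p r P Y & Y `<=` E.

(* Main.v *)
Require Import Defs.
From HB Require Import structures.
From mathcomp Require Import all_boot all_order all_algebra.
From mathcomp Require Import all_classical all_reals all_analysis.
From mathcomp Require Import ring lra zify.
Set Implicit Arguments.
Unset Strict Implicit.
Unset Printing Implicit Defensive.
Import Order.TTheory GRing.Theory Num.Theory.
Import numFieldNormedType.Exports.
Local Open Scope classical_set_scope.
Local Open Scope ring_scope.

(** Write m = n - 2d + 2, so m >= 3. The set E is a checkered pattern of unit cubes:
    x lies in E when m does not divide floor x_1 + ... + floor x_d. The configuration P consists of m equally
    spaced points on the first axis, at -1, 0, ..., m - 2, together with the
    2(d - 1) unit points +e_i and -e_i on the other axes, and the dilation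
    factors are r_j = j m + 1, integers congruent to 1 modulo m.

    Rigidity. A copy of r P is determined by very few equations. As |.|^p is
    strictly convex (p > 1), equality in the triangle inequality is rigid, so
    the midpoint of two points at distances rho, rho, 2 rho is preserved
    ([sum_powR_midpoint]). Hence the copies of +e_i and -e_i are y + v_i and
    y - v_i, where y is the copy of the origin, and the points on the first
    axis stay in arithmetic progression with step v_1. For i <> j all the
    distances from +-v_i to +-v_j are those of +-r e_i and +-r e_j, which is
    the equality case of Clarkson's inequality; since p <> 2, it forces v_i and
    v_j to have disjoint supports ([sum_powR_disjoint]). Here d nonzero vectors
    of R^d with pairwise disjoint supports are supported on single coordinates,
    so v_1 is r or -r times a basis vector ([copy_line_axis]).

    No copies. Along the copy of the progression one coordinate moves by the
    integer step +-r_j and the others are fixed, so the sum of the floors moves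
    by +-1 modulo m at each step. The m consecutive values meet every residue,
    and the point whose residue is 0 is outside E ([no_copy]).

    Density. Slice the cube according to the residue c of the sum of the floors
    of the last d - 1 coordinates: on each slice E is the product of a
    one-dimensional set of period m, which misses one unit interval in m, and
    of a part of the (d - 1)-dimensional cube. The one-dimensional set fills
    (1 - 1/m) s of an interval of length s, up to an error bounded
    independently of s and c, and the parts of the small cube add up to
    s^(d - 1) ([checker_complement_cube_bounds]). Dividing by s^d gives the
    density 1 - 1/m. *)

(** * Strict convexity and Clarkson's inequality for real powers *)

(** Strictness for real exponents comes from e^u > 1 + u (u <> 0), used at
    u = - ln t and at u = (p - 1) ln t. *)
Lemma bernoulli_powR_lt (R : realType) (t p : R) :
  0 <= t -> t != 1 -> 1 < p -> 1 + p * (t - 1) < t `^ p.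
Proof.
move=> t0 t1 p1; have [->|tn0] := eqVneq t 0.
  by rewrite powR0 ?gt_eqF//; lra.
have {t0 tn0} t0 : 0 < t by rewrite lt_neqAle eq_sym tn0.
set l := ln t; have el : expR l = t by rewrite lnK// posrE.
have l0 : l != 0 by apply: contra t1 => /eqP l0; rewrite -el l0 expR0.
have A : 1 + - l < expR (- l) by apply: expR_gt1Dx; rewrite oppr_eq0.
have B : 1 + (p - 1) * l < expR ((p - 1) * l).
  by apply: expR_gt1Dx; apply: mulf_neq0 => //; rewrite subr_eq0 gt_eqF.
have -> : t `^ p = t * expR ((p - 1) * l).
  by rewrite /powR gt_eqF// -{2}el -expRD -/l; congr expR; ring.
have A' : t * (1 - l) < 1.
  by rewrite mulrC -ltr_pdivlMr// mul1r -el -expRN.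
have B' : t * (1 + (p - 1) * l) < t * expR ((p - 1) * l) by rewrite ltr_pM2l.
nra.
Qed.

(** The sum of the tangent inequalities at the midpoint, that is, of Bernoulli's
    inequality at x / m and at y / m: their linear terms cancel. *)
Lemma midpoint_powR_lt (R : realType) (x y p : R) :
  0 <= x -> 0 <= y -> x != y -> 1 < p ->
  2 * ((x + y) / 2) `^ p < x `^ p + y `^ p.
Proof.
move=> x0 y0 xy p1; set m := (x + y) / 2.
have m0 : 0 < m.
  rewrite divr_gt0// lt_neqAle addr_ge0// andbT eq_sym.
  apply: contra xy; rewrite paddr_eq0// => /andP[/eqP -> /eqP ->].
  exact: eqxx.
have bern z : 0 <= z -> z != m -> m `^ p * (1 + p * (z / m - 1)) < z `^ p.
  move=> z0 zm; have {2}-> : z = m * (z / m) by field; exact: lt0r_neq0.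
  have zm0 : 0 <= z / m by rewrite divr_ge0// ltW.
  rewrite (powRM _ (ltW m0) zm0) ltr_pM2l ?powR_gt0//.
  apply: bernoulli_powR_lt => //.
  apply: contra zm => /eqP zm; apply/eqP.
  by rewrite -[LHS](@divfK _ m) ?lt0r_neq0// zm mul1r.
have X := bern x x0; have Y := bern y y0.
have sm : x / m - 1 + (y / m - 1) = 0.
  by rewrite /m; field; move: m0; rewrite /m; lra.
have xm : x != m.
  by apply: contra xy => /eqP; rewrite /m => ?; apply/eqP; lra.
have ym : y != m.
  by apply: contra xy => /eqP; rewrite /m => ?; apply/eqP; lra.
have := ltrD (X xm) (Y ym); rewrite -mulrDr addrACA -mulrDr sm mulr0 addr0.
by rewrite mulrC.
Qed.

Lemma midpoint_powR_le (R : realType) (x y p : R) :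
  0 <= x -> 0 <= y -> 1 < p ->
  2 * ((x + y) / 2) `^ p <= x `^ p + y `^ p.
Proof.
move=> x0 y0 p1; have [<-|xy] := eqVneq x y; last exact/ltW/midpoint_powR_lt.
by rewrite (_ : (x + x) / 2 = x); lra.
Qed.

(** The exponent p turns the triangle inequality |a - b| <= |a| + |b| into one
    that is additive over coordinates and is an equality only for opposite
    numbers. *)
Lemma dist_powR_lt (R : realType) (a b p : R) : 1 < p -> a + b != 0 ->
  2 * `|a - b| `^ p < 2 `^ p * (`|a| `^ p + `|b| `^ p).
Proof.
move=> p1 ab.
have p0 : 0 < p by lra.
have -> : 2 * `|a - b| `^ p = 2 `^ p * (2 * (`|a - b| / 2) `^ p).
  rewrite mulrCA -powRM// ?divr_ge0//; congr (_ * _ `^ _); lra.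
rewrite ltr_pM2l ?powR_gt0//.
have [e|ne] := eqVneq `|a| `|b|.
  have -> : a - b = 0.
    move/eqP: e; rewrite eqr_norm2 => /orP[/eqP->|/eqP e]; first by rewrite subrr.
    by rewrite e addNr eqxx in ab.
  rewrite normr0 mul0r powR0 ?gt_eqF// mulr0.
  have a0 : a != 0.
    by apply: contra ab => /eqP a0; move: e; rewrite a0 normr0 add0r => /esym/eqP;
      rewrite normr_eq0.
  by apply: ltr_pwDl; rewrite ?powR_ge0 ?powR_gt0 ?normr_gt0.
apply: le_lt_trans (midpoint_powR_lt (normr_ge0 a) (normr_ge0 b) ne p1).
rewrite ler_pM2l//; apply: (ge0_ler_powR (ltW p0));
  rewrite ?nnegrE ?divr_ge0 ?addr_ge0//.
by rewrite ler_pM2r ?invr_gt0// ler_normB.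
Qed.

Lemma powR_split (R : realType) (z q : R) : 0 < z -> z `^ q = z * z `^ (q - 1).
Proof.
move=> z0; rewrite -{2}(powRr1 (ltW z0)) -powRD; last by rewrite (gt_eqF z0) implybT.
by congr powR; ring.
Qed.

Lemma powR_superadd (R : realType) (x y q : R) : 0 < x -> 0 < y -> 1 < q ->
  x `^ q + y `^ q < (x + y) `^ q.
Proof.
move=> x0 y0 q1; rewrite (powR_split q x0) (powR_split q y0).
rewrite (powR_split q (addr_gt0 x0 y0)) mulrDl.
by apply: ltrD; rewrite ltr_pM2l// gt0_ltr_powR ?nnegrE; lra.
Qed.

Lemma powR_subadd (R : realType) (x y q : R) : 0 < x -> 0 < y -> 0 < q -> q < 1 ->
  (x + y) `^ q < x `^ q + y `^ q.
Proof.
move=> x0 y0 q0 q1.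
have := @powR_superadd R (x `^ q) (y `^ q) q^-1.
rewrite !powR_gt0// invf_gt1// => /(_ erefl erefl q1).
rewrite -!powRrM mulfV ?gt_eqF// !powRr1 ?ltW// => H.
set w := x `^ q + y `^ q in H *.
have w0 : 0 <= w by rewrite addr_ge0 ?powR_ge0.
rewrite -[ltRHS](powRr1 w0) -(mulVf (lt0r_neq0 q0)) powRrM.
by apply: gt0_ltr_powR; rewrite ?nnegrE ?powR_ge0// addr_ge0// ltW.
Qed.

Lemma powR_sqr_half (R : realType) (z p : R) : `|z| `^ p = (z ^+ 2) `^ (p / 2).
Proof.
by rewrite -real_normK ?num_real// -powR_mulrn// -powRrM; congr powR; field.
Qed.

(** Put q = p / 2 > 1. By the parallelogram law (a + b)^2 and (a - b)^2 have
    mean a^2 + b^2, so by convexity their q-th powers add up to at least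
    2 (a^2 + b^2)^q, and strict superadditivity finishes. *)
Lemma clarkson_gt2 (R : realType) (a b p : R) : 2 < p -> a * b != 0 ->
  2 * (`|a| `^ p + `|b| `^ p) < `|a + b| `^ p + `|a - b| `^ p.
Proof.
move=> p2; rewrite mulf_eq0 negb_or => /andP[a0 b0].
rewrite !powR_sqr_half; set q := p / 2; have q1 : 1 < q by rewrite /q; lra.
have a2 : 0 < a ^+ 2 by rewrite exprn_even_gt0.
have b2 : 0 < b ^+ 2 by rewrite exprn_even_gt0.
have := midpoint_powR_le (sqr_ge0 (a + b)) (sqr_ge0 (a - b)) q1.
rewrite (_ : _ / 2 = a ^+ 2 + b ^+ 2); last by field.
by have := powR_superadd a2 b2 q1; lra.
Qed.

(** The same argument with q < 1: both inequalities reverse, and concavity of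
    the power q is midpoint convexity of the power 1 / q. *)
Lemma clarkson_lt2 (R : realType) (a b p : R) : 0 < p -> p < 2 -> a * b != 0 ->
  `|a + b| `^ p + `|a - b| `^ p < 2 * (`|a| `^ p + `|b| `^ p).
Proof.
move=> p0 p2; rewrite mulf_eq0 negb_or => /andP[a0 b0].
rewrite !powR_sqr_half; set q := p / 2.
have q0 : 0 < q by rewrite /q; lra.
have q1 : q < 1 by rewrite /q; lra.
have a2 : 0 < a ^+ 2 by rewrite exprn_even_gt0.
have b2 : 0 < b ^+ 2 by rewrite exprn_even_gt0.
have qi : 1 < q^-1 by rewrite invf_gt1.
have := midpoint_powR_le (powR_ge0 ((a + b) ^+ 2) q) (powR_ge0 ((a - b) ^+ 2) q) qi.
rewrite -!powRrM mulfV ?gt_eqF// !powRr1 ?sqr_ge0//.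
rewrite (_ : (a + b) ^+ 2 + _ = 2 * (a ^+ 2 + b ^+ 2)); last by ring.
rewrite ler_pM2l// => H.
have S := powR_subadd a2 b2 q0 q1.
suff : ((a + b) ^+ 2) `^ q + ((a - b) ^+ 2) `^ q <= 2 * (a ^+ 2 + b ^+ 2) `^ q by lra.
set w := _ + _ in H *.
rewrite -ler_pdivrMl// mulrC.
have w0 : 0 <= w / 2 by rewrite divr_ge0// addr_ge0 ?powR_ge0.
have -> : w / 2 = ((w / 2) `^ q^-1) `^ q.
  by rewrite -powRrM mulVf ?gt_eqF// powRr1.
by apply: (ge0_ler_powR (ltW q0)); rewrite ?nnegrE ?powR_ge0 ?addr_ge0 ?sqr_ge0.
Qed.

(** * Rigidity of l^p copies *)

(** Equality in a sum of inequalities forces equality in each of them: with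
    x - y = a and z - y = b, the point y is the midpoint of x and z as soon as
    the distances say so. *)
Lemma sum_powR_midpoint (R : realType) (I : finType) (a b : I -> R) (p rho : R) :
  1 < p -> \sum_i `|a i| `^ p = rho -> \sum_i `|b i| `^ p = rho ->
  \sum_i `|a i - b i| `^ p = 2 `^ p * rho -> forall i, a i + b i = 0.
Proof.
move=> p1 ea eb eab i.
pose f i := 2 `^ p * (`|a i| `^ p + `|b i| `^ p) - 2 * `|a i - b i| `^ p.
have f_gt0 j : a j + b j != 0 -> 0 < f j.
  by move=> abj; rewrite subr_gt0 dist_powR_lt.
have f_ge0 j : 0 <= f j.
  have [e|/f_gt0/ltW//] := eqVneq (a j + b j) 0.
  rewrite /f (_ : b j = - a j); last by lra.
  rewrite opprK normrN (_ : a j + a j = 2 * a j); last by ring.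
  by rewrite normrM powRM// ger0_norm//; lra.
have sf : \sum_i f i = 0.
  by rewrite big_split/= sumrN -!mulr_sumr big_split/= ea eb eab; ring.
have /(_ i isT) fi0 := psumr_eq0P (fun j _ => f_ge0 j) sf.
by apply/eqP/negPn/negP => /f_gt0; rewrite fi0 ltxx.
Qed.

(** Equality case of Clarkson's inequality. For p > 2 all the coordinate
    defects are nonnegative, for p < 2 they are all nonpositive, so in either
    case each of them vanishes. *)
Lemma sum_powR_disjoint (R : realType) (I : finType) (a b : I -> R) (p rho : R) :
  1 < p -> p != 2 -> \sum_i `|a i| `^ p = rho -> \sum_i `|b i| `^ p = rho ->
  \sum_i `|a i + b i| `^ p = 2 * rho -> \sum_i `|a i - b i| `^ p = 2 * rho ->
  forall i, a i * b i = 0.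
Proof.
move=> p1 p2 ea eb eD eB i; have p0 : p != 0 by rewrite gt_eqF//; lra.
pose f i := `|a i + b i| `^ p + `|a i - b i| `^ p -
            2 * (`|a i| `^ p + `|b i| `^ p).
have f0 j : a j * b j = 0 -> f j = 0.
  move=> /eqP; rewrite mulf_eq0 /f => /orP[] /eqP ->;
    by rewrite ?add0r ?sub0r ?addr0 ?subr0 ?normrN normr0 powR0//; ring.
have sf : \sum_i f i = 0.
  rewrite big_split/= sumrN -!mulr_sumr !big_split/= ea eb eD eB; ring.
apply/eqP/negPn/negP => abi.
have [p_gt2|p_lt2|e] := ltgtP 2 p; last by rewrite e eqxx in p2.
- have f_ge0 j : 0 <= f j.
    have [/f0->//|abj] := eqVneq (a j * b j) 0.
    by rewrite ltW// subr_gt0 clarkson_gt2.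
  have /(_ i isT) fi0 := psumr_eq0P (fun j _ => f_ge0 j) sf.
  by have := clarkson_gt2 p_gt2 abi; move: fi0; rewrite /f; lra.
- have f_ge0 j : 0 <= - f j.
    have [/f0->//|abj] := eqVneq (a j * b j) 0.
    by rewrite oppr_ge0 ltW// subr_lt0 clarkson_lt2//; lra.
  have sNf : \sum_i - f i = 0 by rewrite sumrN sf oppr0.
  have /(_ i isT) fi0 := psumr_eq0P (fun j _ => f_ge0 j) sNf.
  have := clarkson_lt2 (lt_trans ltr01 p1) p_lt2 abi.
  by move: fi0; rewrite /f; lra.
Qed.

(** Choosing a coordinate s i in the support of each vector v i gives an
    injection, hence a permutation, of the d coordinates; a second coordinate
    in the support of v i would then be chosen by another vector. *)
Lemma disjoint_supports_single (R : realType) (d : nat) (v : 'I_d -> 'I_d -> R) :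
  (forall i, exists k, v i k != 0) ->
  (forall i j k, i != j -> v i k * v j k = 0) ->
  forall i, exists k, v i k != 0 /\ forall l, l != k -> v i l = 0.
Proof.
move=> /choice[s vs] disj i.
have s_inj : injective s.
  move=> j j' e; apply/eqP/negPn/negP => /(disj _ _ (s j))/eqP.
  by rewrite mulf_eq0 (negPf (vs j)) e (negPf (vs j')).
have [s' ss' s's] := injF_bij s_inj.
exists (s i); split => // l ls; apply/eqP/negPn/negP => vil.
have s'li : s' l != i by apply: contra ls => /eqP <-; rewrite s's.
have /eqP := disj _ _ l s'li.
by rewrite mulf_eq0 (negPf vil) orbF -{2}(s's l) (negPf (vs _)).
Qed.

Definition axis_point (R : realType) (d : nat) (i : 'I_d) (c : R) : pointR R d :=
  [tuple if j == i then c else 0 | j < d].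

Lemma tnth_axis_point (R : realType) (d : nat) (i j : 'I_d) (c : R) :
  tnth (axis_point i c) j = if j == i then c else 0.
Proof. by rewrite tnth_mktuple. Qed.

Lemma axis_point0 (R : realType) (d : nat) (i j : 'I_d) :
  axis_point i (0 : R) = axis_point j 0.
Proof. by apply: eq_from_tnth => k; rewrite !tnth_axis_point !if_same. Qed.

(** The p-th power of the l^p distance: unlike the distance, it is a sum over
    coordinates. *)
Definition pdist (R : realType) (d : nat) (p : R) (x y : pointR R d) : R :=
  \sum_i `|tnth x i - tnth y i| `^ p.

Lemma lp_norm_powR (R : realType) (d : nat) (p : R) (x y : pointR R d) : p != 0 ->
  lp_norm p (sub_point x y) `^ p = pdist p x y.
Proof.
move=> p0; rewrite -powRrM mulVf// powRr1; last first.
  by apply: sumr_ge0 => i _; exact: powR_ge0.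
by apply: eq_bigr => i _; rewrite tnth_mktuple.
Qed.

Lemma pdist_axis (R : realType) (d : nat) (p : R) (i : 'I_d) (a b : R) :
  p != 0 -> pdist p (axis_point i a) (axis_point i b) = `|a - b| `^ p.
Proof.
move=> p0; rewrite /pdist (bigD1 i)//= !tnth_axis_point eqxx big1 ?addr0//.
by move=> j ji; rewrite !tnth_axis_point (negPf ji) subrr normr0 powR0.
Qed.

Lemma pdist_axis_neq (R : realType) (d : nat) (p : R) (i j : 'I_d) (a b : R) :
  p != 0 -> i != j ->
  pdist p (axis_point i a) (axis_point j b) = `|a| `^ p + `|b| `^ p.
Proof.
move=> p0 ij; rewrite /pdist (bigD1 i)//= (bigD1 j) 1?eq_sym//=.
rewrite !tnth_axis_point !eqxx (negPf ij) eq_sym (negPf ij).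
rewrite subr0 sub0r normrN big1 ?addr0// => k /andP[ki kj].
by rewrite !tnth_axis_point (negPf ki) (negPf kj) subrr normr0 powR0.
Qed.

Lemma pdist_midpoint (R : realType) (d : nat) (p rho : R) (x y z : pointR R d) :
  1 < p -> pdist p x y = rho -> pdist p z y = rho -> pdist p x z = 2 `^ p * rho ->
  forall i, tnth x i - tnth y i = - (tnth z i - tnth y i).
Proof.
move=> p1 xy zy xz i; apply/eqP; rewrite -subr_eq0 opprK; apply/eqP.
apply: (sum_powR_midpoint p1 xy zy); rewrite -xz; apply: eq_bigr => j _.
by congr (`|_| `^ _); ring.
Qed.

(** Extrapolation of an arithmetic progression. The progression is indexed from
    -1, so that its second point is the origin. *)
Lemma affine_step (R : realType) (x o v : R) (n : nat) :
  x - (o + (n.+1%:R - 1) * v) =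
    - ((o + (n%:R - 1) * v) - (o + (n.+1%:R - 1) * v)) ->
  x = o + (n.+2%:R - 1) * v.
Proof.
rewrite -[n.+2]addn2 -[n.+1]addn1 !natrD => /eqP.
by rewrite subr_eq => /eqP ->; ring.
Qed.

Section rigidity.
Context (R : realType) (d : nat) (p r : R) (m : nat).
Context (p1 : 1 < p) (p2 : p != 2) (r0 : 0 < r) (m3 : (3 <= m)%N).
Context (phi : pointR R d.+1 -> pointR R d.+1) (P : set (pointR R d.+1)).
Context (P_line : forall k, (k < m)%N -> P (axis_point ord0 (k%:R - 1))).
Context (P_axes : forall i, P (axis_point i 1) /\ P (axis_point i (-1))).
Context (phi_dist : forall u v, P u -> P v ->
  pdist p (phi u) (phi v) = r `^ p * pdist p u v).

Let p0 : p != 0. Proof. by rewrite gt_eqF// (lt_trans ltr01). Qed.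

Let origin : pointR R d.+1 := axis_point ord0 0.

Let P_origin : P origin.
Proof. by have := P_line (ltnW m3); rewrite subrr. Qed.

Let dist_origin i c : pdist p (axis_point i c) origin = `|c| `^ p.
Proof. by rewrite /origin (axis_point0 _ ord0 i) pdist_axis// subr0. Qed.

Let v (i k : 'I_d.+1) : R := tnth (phi (axis_point i 1)) k - tnth (phi origin) k.
Let w (i k : 'I_d.+1) : R :=
  tnth (phi (axis_point i (-1))) k - tnth (phi origin) k.

Let dist_v i : \sum_k `|v i k| `^ p = r `^ p.
Proof.
have [Pi _] := P_axes i.
by have := phi_dist Pi P_origin; rewrite dist_origin normr1 powR1 mulr1.
Qed.

(** The origin is the midpoint of -e_i and +e_i, and phi preserves midpoints. *)
Let w_opp i k : w i k = - v i k.
Proof.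
have [Pi PNi] := P_axes i; apply: (pdist_midpoint (rho := r `^ p) p1).
- by rewrite phi_dist// dist_origin normrN normr1 powR1 mulr1.
- by have := dist_v i.
- rewrite phi_dist// pdist_axis// mulrC; congr (_ `^ _ * _).
  by rewrite -opprD normrN ger0_norm//.
Qed.

(** By [w_opp], v i + v j is the difference of the images of +e_i and -e_j, so
    both v i + v j and v i - v j have the norm that r e_i + r e_j has. *)
Let v_disjoint i j k : i != j -> v i k * v j k = 0.
Proof.
move=> ij; have [Pi _] := P_axes i; have [Pj PNj] := P_axes j.
apply: (sum_powR_disjoint p1 p2 (dist_v i) (dist_v j)).
- transitivity (pdist p (phi (axis_point i 1)) (phi (axis_point j (-1)))).
    apply: eq_bigr => l _; congr (`|_| `^ _).
    by rewrite -[v j l]opprK -w_opp /v /w; ring.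
  rewrite phi_dist// pdist_axis_neq// normrN normr1 powR1; ring.
- transitivity (pdist p (phi (axis_point i 1)) (phi (axis_point j 1))).
    by apply: eq_bigr => l _; congr (`|_| `^ _); rewrite /v; ring.
  by rewrite phi_dist// pdist_axis_neq// normr1 powR1; ring.
Qed.

(** The claim for two consecutive points is inductive: the middle one of three
    consecutive points is the midpoint of the other two. *)
Let line_affine n k : (n.+1 < m)%N ->
  tnth (phi (axis_point ord0 (n%:R - 1))) k =
    tnth (phi origin) k + (n%:R - 1) * v ord0 k /\
  tnth (phi (axis_point ord0 (n.+1%:R - 1))) k =
    tnth (phi origin) k + (n.+1%:R - 1) * v ord0 k.
Proof.
elim: n => [_|n IH nm].
  rewrite sub0r subrr mul0r addr0 mulN1r; split => //.
  by rewrite -w_opp /w; ring.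
have [I0 I1] := IH (ltnW nm); split => //.
have phi_line a b : (a < m)%N -> (b < m)%N ->
    pdist p (phi (axis_point ord0 (a%:R - 1))) (phi (axis_point ord0 (b%:R - 1)))
    = r `^ p * `|a%:R - b%:R| `^ p.
  move=> am bm; rewrite (phi_dist (P_line am) (P_line bm)) pdist_axis//.
  by congr (_ * `|_| `^ _); ring.
have n1m : (n.+1 < m)%N by lia.
have n0m : (n < m)%N by lia.
have d1 : pdist p (phi (axis_point ord0 (n.+2%:R - 1)))
    (phi (axis_point ord0 (n.+1%:R - 1))) = r `^ p.
  rewrite phi_line// (_ : _ - _ = 1) ?normr1 ?powR1 ?mulr1//.
  by rewrite -[n.+2]addn1 natrD; ring.
have d2 : pdist p (phi (axis_point ord0 (n%:R - 1)))
    (phi (axis_point ord0 (n.+1%:R - 1))) = r `^ p.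
  rewrite phi_line// (_ : _ - _ = - 1) ?normrN ?normr1 ?powR1 ?mulr1//.
  by rewrite -[n.+1]addn1 natrD; ring.
have d3 : pdist p (phi (axis_point ord0 (n.+2%:R - 1)))
    (phi (axis_point ord0 (n%:R - 1))) = 2 `^ p * r `^ p.
  rewrite phi_line// (_ : _ - _ = 2) ?ger0_norm 1?mulrC//.
  by rewrite -[n.+2]addn2 natrD; ring.
have := pdist_midpoint p1 d1 d2 d3 k; rewrite I0 I1 => H.
exact: affine_step H.
Qed.

(** The vectors v i are nonzero with disjoint supports, so v ord0, the step of
    the image progression, has a single nonzero coordinate; as its l^p norm is
    r, that coordinate is r or -r. *)
Lemma copy_line_axis : exists (l : 'I_d.+1) (b : bool),
  forall k i, (k < m)%N ->
    tnth (phi (axis_point ord0 (k%:R - 1))) i =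
    tnth (phi (axis_point ord0 0)) i +
      if i == l then (k%:R - 1) * ((-1) ^+ b * r) else 0.
Proof.
have v_neq0 i : exists k, v i k != 0.
  apply: contrapT => /forallNP v0; have := dist_v i.
  rewrite big1 => [/esym/eqP|k _]; first by rewrite gt_eqF// powR_gt0.
  by have /negP/negPn/eqP -> := v0 k; rewrite normr0 powR0.
have [l [vl v0]] := disjoint_supports_single v_neq0 v_disjoint ord0.
have vlr : v ord0 l = (-1) ^+ (v ord0 l < 0)%R * r.
  rewrite {1}[v ord0 l]numEsign; congr (_ * _).
  have := dist_v ord0; rewrite (bigD1 l)//= big1 ?addr0 => [|k kl].
    by apply: powR_injective; rewrite ?nnegrE ?(ltW r0)// (lt_trans ltr01).
  by rewrite v0// normr0 powR0.
exists l, (v ord0 l < 0) => k i km.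
have -> : tnth (phi (axis_point ord0 (k%:R - 1))) i =
    tnth (phi origin) i + (k%:R - 1) * v ord0 i.
  case: k km => [_|k km]; first exact: (line_affine i (ltnW m3)).1.
  exact: (line_affine i km).2.
rewrite -/origin; congr (_ + _); have [->|il] := eqVneq i l; first by rewrite {1}vlr.
by rewrite v0// mulr0.
Qed.
End rigidity.

(** * The checkered set and the configuration *)

Definition floor_sum (R : realType) (d : nat) (x : pointR R d) : int :=
  \sum_(i < d) Num.floor (tnth x i : R).

Definition checker_complement (R : realType) (d m : nat) : set (pointR R d) :=
  [set x | ~~ (m %| floor_sum x)%Z].

(** Ambient dimension d + 1: the m points on the first axis start at -1, so that
    they contain the origin and both unit points of that axis as soon as
    m >= 3. *)
Definition configuration_point (R : realType) (d m : nat)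
    (t : 'I_m + 'I_d * bool) : pointR R d.+1 :=
  match t with
  | inl k => axis_point ord0 ((k : nat)%:R - 1)
  | inr (i, b) => axis_point (lift ord0 i) ((-1) ^+ b)
  end.

Definition configuration (R : realType) (d m : nat) : set (pointR R d.+1) :=
  range (@configuration_point R d m).

Arguments checker_complement : clear implicits.
Arguments configuration : clear implicits.

Lemma axis_point_inj (R : realType) (d : nat) (i j : 'I_d) (a b : R) :
  a != 0 -> axis_point i a = axis_point j b -> i = j /\ a = b.
Proof.
move=> a0 e; have := congr1 (fun x => tnth x i) e.
rewrite !tnth_axis_point eqxx; have [-> //|_ a00] := eqVneq i j.
by rewrite a00 eqxx in a0.
Qed.

Lemma configuration_point_inj (R : realType) (d m : nat) :
  injective (@configuration_point R d m).
Proof.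
have sgn0 (b : bool) : (-1) ^+ b != 0 :> R by rewrite signr_eq0.
move=> [k|[i b]] [k'|[i' b']] /=.
- move=> /(congr1 (fun x => tnth x ord0)); rewrite !tnth_axis_point eqxx.
  by move=> /addIr/eqP; rewrite eqr_nat => /eqP/val_inj ->.
- by move/esym => /(axis_point_inj (sgn0 b'))[].
- by move=> /(axis_point_inj (sgn0 b))[].
- move=> /(axis_point_inj (sgn0 b))[/lift_inj -> /eqP].
  by rewrite (inj_eq signr_inj) => /eqP ->.
Qed.

Lemma card_configuration (R : realType) (d m : nat) :
  (configuration R d m #= `I_(m + d * 2))%card.
Proof.
have cardT : #|{: 'I_m + 'I_d * bool}| = (m + d * 2)%N.
  by rewrite card_sum card_prod !card_ord card_bool.
rewrite -cardT card_eq_sym; apply: card_eq_trans card_II _.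
rewrite card_eq_sym.
pose f (i : 'I_#|{: 'I_m + 'I_d * bool}|) : pointR R d.+1 :=
  configuration_point R (enum_val i).
have -> : configuration R d m = range f.
  apply/seteqP; split => _ [t _ <-]; last by exists (enum_val t).
  by exists (enum_rank t) => //; rewrite /f enum_rankK.
apply: inj_card_eq => x y _ _ /configuration_point_inj/enum_val_inj; exact.
Qed.

Lemma configuration_line (R : realType) (d m k : nat) : (k < m)%N ->
  configuration R d m (axis_point ord0 (k%:R - 1)).
Proof. by move=> km; exists (inl (Ordinal km)). Qed.

Lemma configuration_axes (R : realType) (d m : nat) (i : 'I_d.+1) :
  (3 <= m)%N ->
  configuration R d m (axis_point i 1) /\
  configuration R d m (axis_point i (-1)).
Proof.
move=> m3; case: (unliftP ord0 i) => [j|] ->.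
  by split; [exists (inr (j, false)) | exists (inr (j, true))].
split.
  have := configuration_line R d (m3 : (2 < m)%N).
  by rewrite (_ : 2%:R - 1 = 1)//; ring.
by have := configuration_line R d (ltnW (ltnW m3) : (0 < m)%N); rewrite sub0r.
Qed.

Lemma floor_sum_shift (R : realType) (d : nat) (x y : pointR R d) (l : 'I_d)
    (z : int) :
  (forall i, tnth x i = (tnth y i : R) + if i == l then z%:~R else 0) ->
  floor_sum x = floor_sum y + z.
Proof.
move=> xy; rewrite /floor_sum (bigD1 l)//= [in RHS](bigD1 l)//=.
rewrite xy eqxx floorDrz ?intr_int// intrKfloor -!addrA; congr (_ + _).
rewrite addrC; congr (_ + _); apply: eq_bigr => i il.
by rewrite xy (negPf il) addr0.
Qed.

Lemma lp_copy_pdist (R : realType) (d : nat) (p r : R) (u v x y : pointR R d) :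
  p != 0 -> 0 <= r ->
  lp_norm p (sub_point x y) = r * lp_norm p (sub_point u v) ->
  pdist p x y = r `^ p * pdist p u v.
Proof.
by move=> p0 r0 e; rewrite -!lp_norm_powR// e powRM// powR_ge0.
Qed.

(** Modulo m the step is e = (-1)^b, so k - 1 should be -e a, because e^2 = 1. *)
Lemma residue_hit (m j : nat) (a : int) (b : bool) : (0 < m)%N ->
  exists2 k : nat, (k < m)%N &
    (m %| a + (k%:Z - 1) * ((-1) ^+ b * (j * m + 1)%:Z))%Z.
Proof.
move=> m0; set e : int := (-1) ^+ b.
have e2 : e * e = 1 by rewrite /e -expr2 sqrr_sign.
have mz : (m%:Z != 0) by lia.
have /andP[k0 km] : 0 <= ((1 - e * a) %% m)%Z < m%:Z.
  by rewrite modz_ge0// ltz_pmod.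
exists `|((1 - e * a) %% m)%Z|%N; first lia.
rewrite gez0_abs//.
have -> : ((1 - e * a) %% m)%Z = (1 - e * a) - ((1 - e * a) %/ m)%Z * m.
  by rewrite {2}(divz_eq (1 - e * a) m); ring.
set q := (_ %/ _)%Z.
have -> : a + (1 - e * a - q * m - 1) * (e * (j * m + 1)%:Z) =
   a * (1 - e * e) + (- (e * e) * a * j - q * e * (j * m + 1)%:Z) * m.
  by rewrite PoszD PoszM; ring.
by rewrite e2 subrr mulr0 add0r dvdz_mull.
Qed.

(** The m points on the first axis are sent along a coordinate line with the
    integer step +-(j m + 1), so the image of one of them has a sum of floors
    divisible by m. *)
Lemma no_copy (R : realType) (d m j : nat) (p : R) :
  1 < p -> p != 2 -> (3 <= m)%N ->
  ~ contains_lp_copy p (j * m + 1)%:R (configuration R d m)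
      (checker_complement R d.+1 m).
Proof.
move=> p1 p2 m3 [Y [phi phi_bij phi_dist] YE].
have p0 : p != 0 by rewrite gt_eqF// (lt_trans ltr01).
set r : R := _%:R in phi_dist.
have r0 : 0 < r by rewrite ltr0n addn1.
have [l [b phi_line]] := copy_line_axis p1 p2 r0 m3
  (@configuration_line R d m) (fun i => configuration_axes R i m3)
  (fun u v Pu Pv => lp_copy_pdist p0 (ltW r0) (phi_dist u v Pu Pv)).
have [k km hit] := residue_hit j (floor_sum (phi (axis_point ord0 0))) b
  (ltnW (ltnW m3)).
have shift i : tnth (phi (axis_point ord0 (k%:R - 1))) i =
    (tnth (phi (axis_point ord0 0)) i : R) +
    if i == l then ((k%:Z - 1) * ((-1) ^+ b * (j * m + 1)%:Z))%:~R else 0.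
  rewrite phi_line//; congr (_ + _); case: ifP => // _.
  by rewrite rmorphM rmorphB rmorphM rmorph_sign.
have /YE : Y (phi (axis_point ord0 (k%:R - 1))).
  by case: phi_bij => fY _ _; apply: fY; exact: configuration_line.
by rewrite /checker_complement/= (floor_sum_shift shift) hit.
Qed.

(** * Measurability and one-dimensional measure *)

Lemma measurable_floor_preimage (R : realType) (Q : int -> Prop) :
  measurable [set t : measurableTypeR R | Q (Num.floor (t : R))].
Proof.
have -> : [set t : measurableTypeR R | Q (Num.floor (t : R))] =
    \bigcup_(k in [set: int])
      (if `[< Q k >] then `[k%:~R, (k + 1)%:~R[%classic else set0).
  apply/seteqP; split => t /=.
    move=> Qt; exists (Num.floor (t : R)) => //.
    by rewrite asboolT//= in_itv/= floor_itv.
  move=> [k _]; case: asboolP => // Qk.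
  by rewrite /= in_itv/= -floor_eq => /eqP ->.
apply: countable_bigcupT_measurable => [|k]; first exact: countableP.
by case: asboolP => _; [exact: measurable_itv | exact: measurable0].
Qed.

Lemma tnth_tail_point (R : realType) (d : nat) (x : pointR R d.+1) (i : 'I_d) :
  tnth (tail_point x) i = tnth x (lift ord0 i).
Proof. by rewrite /tail_point [in RHS](tuple_eta x) tnthS. Qed.

Lemma floor_sumS (R : realType) (d : nat) (x : pointR R d.+1) :
  floor_sum x = Num.floor (tnth x ord0 : R) + floor_sum (tail_point x).
Proof.
rewrite /floor_sum big_ord_recl; congr (_ + _).
by apply: eq_bigr => i _; rewrite tnth_tail_point.
Qed.

Lemma measurable_tnth_preimage (R : realType) (d : nat) (i : 'I_d)
    (A : set (measurableTypeR R)) :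
  measurable A -> measurable [set x : pointR R d | A (tnth x i)].
Proof.
move=> mA; rewrite -[X in measurable X]setTI.
exact: (@measurable_tnth _ (measurableTypeR R) d i).
Qed.

Lemma measurable_tail_preimage (R : realType) (d : nat) (B : set (pointR R d)) :
  measurable B -> measurable [set x : pointR R d.+1 | B (tail_point x)].
Proof.
move=> mB; rewrite -[X in measurable X]setTI.
exact: (@measurable_behead _ (measurableTypeR R) d).
Qed.

(** Arbitrary predicates make the induction on the dimension work: splitting off
    the value k of the first floor shifts the predicate by k. *)
Lemma measurable_floor_sum_preimage (R : realType) (d : nat) (Q : int -> Prop) :
  measurable [set x : pointR R d | Q (floor_sum x)].
Proof.
elim: d Q => [|d IH] Q.
  rewrite (_ : [set _ | _] = if `[< Q 0 >] then setT else set0).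
    by case: ifP.
  by apply/seteqP; split => x; rewrite /floor_sum /= big_ord0; case: asboolP.
have -> : [set x : pointR R d.+1 | Q (floor_sum x)] =
    \bigcup_(k in [set: int])
      ([set x | (Num.floor (tnth x ord0 : R) = k)] `&`
       [set x | Q (k + floor_sum (tail_point x))]).
  apply/seteqP; split => x /=.
    by rewrite floor_sumS => Qx; exists (Num.floor (tnth x ord0 : R)).
  by move=> [k _ [/= xk]]; rewrite floor_sumS xk.
apply: countable_bigcupT_measurable => [|k]; first exact: countableP.
apply: measurableI.
  exact: (@measurable_tnth_preimage _ _ ord0 _
    (@measurable_floor_preimage R (fun l => l = k))).
exact: (@measurable_tail_preimage _ _ _ (IH (fun l => Q (k + l)))).
Qed.

Lemma measurable_checker_complement (R : realType) (d m : nat) :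
  measurable (checker_complement R d m).
Proof. exact: (@measurable_floor_sum_preimage R d (fun k => ~~ (m %| k)%Z)). Qed.

Lemma cube_box (R : realType) (d : nat) (s : R) :
  cube s =
  [set x : pointR R d | forall i, `[- (s / 2), s / 2]%classic (tnth x i : R)].
Proof. by apply/seteqP; split => x h i; have := h i; rewrite /= in_itv. Qed.

Lemma measurable_cube (R : realType) (d : nat) (s : R) :
  measurable (cube s : set (pointR R d)).
Proof.
rewrite cube_box (_ : [set _ | _] = \bigcap_(i in [set: 'I_d])
    [set x | `[- (s / 2), s / 2]%classic (tnth x i : R)]).
  apply: fin_bigcap_measurable => // i _.
  by apply: measurable_tnth_preimage; exact: measurable_itv.
by apply/seteqP; split => x /= h i; [move=> _; exact: h | exact: (h i I)].
Qed.

Lemma borel_lebesgue_cube (R : realType) (d : nat) (s : R) : 0 < s ->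
  borel_lebesgue R d (cube s) = (s ^+ d)%:E.
Proof.
move=> s0; rewrite cube_box.
rewrite (borel_lebesgue_box (A := fun=> `[- (s / 2), s / 2]%classic))//.
rewrite (eq_bigr (fun=> s%:E)) => [|i _]; last first.
  rewrite lebesgue_measure_itv/= lte_fin ifT; last lra.
  by rewrite -EFinB; congr (_%:E); lra.
by elim: d => [|d IH]; rewrite ?big_ord0// big_ord_recr/= IH -EFinM exprSr.
Qed.

Lemma lebesgueE (R : realType) (d : nat) (E : set (pointR R d)) :
  measurable E -> lebesgue E = borel_lebesgue R d E.
Proof.
by move=> mE; rewrite /lebesgue /completed_measure_extension measurable_mu_extE.
Qed.

Lemma lebesgue_measurableW (R : realType) (d : nat) (E : set (pointR R d)) :
  measurable E -> lebesgue_measurable E.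
Proof. by move=> mE; apply: sub_caratheodory; exact: sub_sigma_algebra. Qed.

(** The section of the checkered set over a point whose remaining coordinates
    have floors of sum c. *)
Definition line_complement (R : realType) (m : nat) (c : int) :
    set (measurableTypeR R) :=
  [set t | ~~ (m %| Num.floor (t : R) + c)%Z].
Arguments line_complement : clear implicits.

Lemma measurable_line_complement (R : realType) (m : nat) (c : int) :
  measurable (line_complement R m c).
Proof. exact: (measurable_floor_preimage (fun k => ~~ (m %| k + c)%Z)). Qed.

Lemma dvdz_next (m : nat) (a x : int) :
  (m %| a)%Z -> 0 < x < m -> ~~ (m %| a + x)%Z.
Proof.
move=> /dvdzP[q ->] xm; apply/negP => /dvdzP[q' e].
have xE : x = (q' - q) * m by rewrite mulrBl -e; ring.
have m0 : 0 < m%:Z by lia.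
move: xm; rewrite xE pmulr_lgt0// => /andP[k0].
by rewrite -[ltRHS]mul1r ltr_pM2r//; lia.
Qed.

(** A block of m unit intervals that starts where m divides floor t + c loses
    exactly its first interval. *)
Lemma line_complement_blocks (R : realType) (m : nat) (c a : int) (n : nat) :
  (0 < m)%N -> (m %| a + c)%Z ->
  lebesgue_measure (line_complement R m c `&`
     `[a%:~R, (a + (n * m)%N%:Z)%:~R[%classic) = (n * m.-1)%:R%:E.
Proof.
move=> m0 mac; elim: n => [|n IH].
  rewrite !mul0n addr0 (_ : _ `&` _ = set0) ?measure0//.
  by apply/seteqP; split => t //= [_]; rewrite in_itv/=; lra.
set b := a + (n * m)%N%:Z in IH *.
have mbc : (m %| b + c)%Z.
  by rewrite /b addrAC rpredD// PoszM dvdz_mull.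
have -> : line_complement R m c `&`
      `[a%:~R, (a + (n.+1 * m)%N%:Z)%:~R[%classic =
    (line_complement R m c `&` `[a%:~R, b%:~R[%classic) `|`
    `[(b + 1)%:~R, (b + m)%:~R[%classic.
  apply/seteqP; split => t /=; rewrite /line_complement /= !in_itv/=;
    rewrite -!floor_ge_int -!floor_lt_int; set f := Num.floor t.
    move=> [mf /andP[af fb]]; have [fb'|bf] := ltP f b.
      by left; rewrite af.
    right; apply/andP; split; last by rewrite /b; lia.
    (* Past the end b of the first n blocks only the cell of b is removed. *)
    rewrite -ltzD1 addrC addrA; apply/negPn/negP => ?.
    have fb' : f = b by lia.
    by rewrite fb' mbc in mf.
  move=> [[-> /andP[-> fb]]|/andP[bf fb]].
    by split => //; rewrite /b in fb *; lia.
  split; last by rewrite /b in bf fb *; lia.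
  have -> : f + c = b + c + (f - b) by ring.
  by apply: dvdz_next => //; lia.
rewrite measureU//.
- rewrite [X in (X + _)%E]IH [X in (_ + X)%E]lebesgue_measure_itv/= lte_fin ltr_int.
  case: ifPn => bm; last first.
    by rewrite adde0 (_ : m = 1)%N ?muln0//; lia.
  rewrite -EFinD; congr (_%:E).
  rewrite -rmorphB (_ : b + m - (b + 1) = m.-1%:Z); last lia.
  by rewrite -natrD mulSnr.
- by apply: measurableI; [exact: measurable_line_complement | exact: measurable_itv].
- apply/seteqP; split => t //= [[_]]; rewrite !in_itv/= -!floor_ge_int -!floor_lt_int.
  by lia.
Qed.

(** * Density *)

Lemma line_complement_window (R : realType) (m c N : nat) : (0 < m)%N ->
  lebesgue_measure (line_complement R m c `&`
     `[- (m%:R * N%:R) - c%:R, m%:R * N%:R - c%:R[%classic) =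
  (2 * N%:R * (m%:R - 1))%:E.
Proof.
move=> m0; pose a : int := - (m * N)%N%:Z - c%:Z.
have mac : (m %| a + c%:Z)%Z by rewrite /a subrK rpredN PoszM dvdz_mulr.
have := line_complement_blocks R (2 * N) m0 mac.
have -> : a%:~R = - (m%:R * N%:R) - c%:R :> R.
  by rewrite rmorphB rmorphN /= -!pmulrn natrM.
have -> : (a + (2 * N * m)%N%:Z)%:~R = m%:R * N%:R - c%:R :> R.
  rewrite (_ : _ + _ = (m * N)%N%:Z - c%:Z) ?rmorphB/= -?pmulrn ?natrM//.
  by rewrite /a; lia.
by move=> ->; rewrite -subn1 !natrM natrB.
Qed.

(** The interval is filled from inside and covered from outside by windows made
    of whole blocks, whose lengths differ by a bounded number of blocks. *)
Lemma line_complement_bounds (R : realType) (m c : nat) (s : R) :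
  (c < m)%N -> 2 * m%:R <= s ->
  (((1 - m%:R^-1) * s - 4 * m%:R)%:E <=
   lebesgue_measure (line_complement R m c `&` `[(- (s / 2))%R, (s / 2)%R]%classic) <=
   ((1 - m%:R^-1) * s + 4 * m%:R)%:E)%E.
Proof.
move=> cm sm; have m0 : (0 < m)%N by apply: leq_ltn_trans cm.
set M : R := m%:R; have M0 : 0 < M by rewrite ltr0n.
have M1 : 1 <= M by rewrite ler1n.
have c0 : 0 <= c%:R :> R by [].
have cM : c%:R < M by rewrite ltr_nat.
pose X := s / (2 * M); have sX : s = 2 * M * X by rewrite /X; field; exact: lt0r_neq0.
have X1 : 1 <= X by rewrite /X ler_pdivlMr ?mul1r// mulr_gt0.
have /andP[NX XN] := truncn_itv (le_trans ler01 X1).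
(* The window of radius M (N - 1), shifted by c <= M, is inside the interval,
   and the one of radius M (N + 2) covers it. *)
set N := Num.trunc X in NX XN.
have N0 : (0 < N)%N by rewrite -(ltr_nat R); move: XN; rewrite -natr1; lra.
have -> : (1 - M^-1) * s = 2 * (M - 1) * X by rewrite sX; field; exact: lt0r_neq0.
have -> : s / 2 = M * X by rewrite sX; field.
have mJ a b : measurable (line_complement R m c `&` [set` Interval a b]).
  by apply: measurableI; [exact: measurable_line_complement|exact: measurable_itv].
have MNX : M * N%:R <= M * X by rewrite ler_pM2l.
have MXN : M * X < M * (N%:R + 1) by rewrite ltr_pM2l// natr1.
apply/andP; split.
  have NE : N.-1%:R = N%:R - 1 :> R by rewrite -subn1 natrB.
  apply: (@le_trans _ _ (2 * N.-1%:R * (M - 1))%:E).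
    by rewrite lee_fin NE; move: XN; rewrite -natr1; nra.
  rewrite -(line_complement_window _ c)// le_measure ?inE//; try exact: mJ.
  apply: setIS => t /=; rewrite !in_itv/= NE -/M => /andP[t1 t2].
  by apply/andP; split; lra.
apply: (@le_trans _ _ (2 * N.+2%:R * (M - 1))%:E); last first.
  by rewrite lee_fin -addn2 natrD; nra.
rewrite -(line_complement_window _ c)// le_measure ?inE//; try exact: mJ.
apply: setIS => t /=; rewrite !in_itv/= -addn2 natrD -/M => /andP[t1 t2].
by apply/andP; split; lra.
Qed.

Definition residue_class (R : realType) (d m c : nat) : set (pointR R d) :=
  [set x | (floor_sum x %% m)%Z = c].
Arguments residue_class : clear implicits.

Lemma measurable_residue_class (R : realType) (d m c : nat) :
  measurable (residue_class R d m c).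
Proof. exact: (@measurable_floor_sum_preimage R d (fun k => (k %% m)%Z = c)). Qed.

Lemma residue_class_cover (R : realType) (d m : nat) : (0 < m)%N ->
  \big[setU/set0]_(c < m) residue_class R d m c = setT.
Proof.
move=> m0; apply/seteqP; split => // x _; rewrite -bigcup_mkord.
have mz : m%:Z != 0 by lia.
exists `|(floor_sum x %% m)%Z|%N => /=.
  by have := modz_ge0 (floor_sum x) mz; have := ltz_pmod (floor_sum x) (d := m); lia.
by rewrite /residue_class/= gez0_abs// modz_ge0.
Qed.

Lemma trivIset_residue_class (R : realType) (d m : nat) :
  trivIset setT (residue_class R d m).
Proof. by move=> c c' _ _ [x [/= + e]]; rewrite /residue_class /= e => -[]. Qed.

Definition slice (R : realType) (d m : nat) (s : R) (c : nat) :
    set (pointR R d.+1) :=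
  [set x |
    (line_complement R m c `&` `[- (s / 2), s / 2]%classic) (tnth x ord0) /\
    (residue_class R d m c `&` cube s) (tail_point x)].
Arguments slice {R} d m s c.

(** Once the residue c of the tail is fixed, membership in the checkered set
    depends on the first coordinate only: each slice is a product. *)
Lemma checker_complement_slices (R : realType) (d m : nat) (s : R) : (0 < m)%N ->
  checker_complement R d.+1 m `&` cube s =
  \big[setU/set0]_(c < m) slice d m s c.
Proof.
move=> m0; rewrite -bigcup_mkord.
have cubeE (x : pointR R d.+1) : cube s x <->
    `[- (s / 2), s / 2]%classic (tnth x ord0 : R) /\ cube s (tail_point x).
  rewrite /= in_itv/=; split.
    by move=> h; split => [|i]; rewrite ?tnth_tail_point; exact: h.
  move=> [h0 h] i; case: (unliftP ord0 i) => [j|] -> //.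
  by have := h j; rewrite tnth_tail_point.
have residueE (x : pointR R d.+1) (c : nat) :
    residue_class R d m c (tail_point x) ->
    checker_complement R d.+1 m x <-> line_complement R m c (tnth x ord0).
  rewrite /residue_class /checker_complement /line_complement /= floor_sumS => xc.
  rewrite (divz_eq (floor_sum (tail_point x)) m) xc addrCA addrC.
  by rewrite rpredDr// dvdz_mull.
have cover x : exists2 c, (c < m)%N & residue_class R d m c x.
  have : (\big[setU/set0]_(c < m) residue_class R d m c) x.
    by rewrite residue_class_cover.
  by rewrite -bigcup_mkord => -[c ? ?]; exists c.
apply/seteqP; split => x.
  move=> [Ex /cubeE[x0 xt]]; have [c cm xc] := cover (tail_point x).
  by exists c => //; do ![split => //]; apply/(residueE _ _ xc).
move=> [c cm [[lx x0] [xc xt]]]; split; first exact/(residueE _ _ xc).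
exact/cubeE.
Qed.

(** Every slice is a product of measure |L c| |T c|, where |L c| is known up to a
    constant and the sets T c partition the cube of one dimension less. *)
Lemma checker_complement_cube_bounds (R : realType) (d m : nat) (s : R) :
  (0 < m)%N -> 2 * m%:R <= s ->
  (((((1 - m%:R^-1) * s - 4 * m%:R) * s ^+ d)%:E <=
   borel_lebesgue R d.+1 (checker_complement R d.+1 m `&` cube s) <=
   (((1 - m%:R^-1) * s + 4 * m%:R) * s ^+ d)%:E))%E.
Proof.
move=> m0 sm; have M0 : 0 < m%:R :> R by rewrite ltr0n.
have s0 : 0 < s by lra.
pose L c := line_complement R m c `&` `[- (s / 2), s / 2]%classic.
pose T c := residue_class R d m c `&` cube s.
have mL c : measurable (L c).
  by apply: measurableI; [exact: measurable_line_complement|exact: measurable_itv].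
have mT c : measurable (T c).
  by apply: measurableI; [exact: measurable_residue_class|exact: measurable_cube].
have -> : borel_lebesgue R d.+1 (checker_complement R d.+1 m `&` cube s) =
    (\sum_(c < m) lebesgue_measure (L c) * borel_lebesgue R d (T c))%E.
  rewrite checker_complement_slices//.
  rewrite measure_bigsetU.
  - by apply: eq_bigr => c _; exact: (cons_measureE (borel_lebesgue R d) (mL c) (mT c)).
  - move=> c; apply: measurableI.
      exact: (@measurable_tnth_preimage _ _ ord0 _ (mL c)).
    exact: (measurable_tail_preimage (mT c)).
  - move=> c c' _ _ [x [[_ [xc _]] [_ [xc' _]]]].
    by apply: (@trivIset_residue_class R d m) => //; exists (tail_point x).
have sumT : (\sum_(c < m) borel_lebesgue R d (T c))%E = (s ^+ d)%:E.
  rewrite -borel_lebesgue_cube// -measure_bigsetU//.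
    by rewrite /T -big_distrl/= residue_class_cover// setTI.
  by apply: trivIset_setIr; exact: trivIset_residue_class.
rewrite !EFinM -sumT !ge0_sume_distrr//.
by apply/andP; split; apply: lee_sum => c _; apply: lee_wpmul2r => //;
  have /andP[] := line_complement_bounds (ltn_ord c) sm.
Qed.

Lemma has_density_checker_complement (R : realType) (d m : nat) : (0 < m)%N ->
  has_density (checker_complement R d.+1 m) (1 - m%:R^-1).
Proof.
move=> m0; set delta := 1 - _.
have invs : (s : R)^-1 @[s --> +oo] --> (0 : R).
  apply/gtr0_cvgV0 => //; exact: nbhs_pinfty_gt.
have lim (C : R) : (delta + C * s^-1)%:E @[s --> +oo] --> delta%:E.
  apply: cvg_EFin; first by near=> s.
  rewrite -[X in _ --> X]addr0 -(mulr0 C).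
  by apply: cvgD; [exact: cvg_cst | apply: cvgM; [exact: cvg_cst | exact: invs]].
apply: squeeze_cvge (lim (- (4 * m%:R))) (lim (4 * m%:R)).
near=> s.
have sm : 2 * m%:R <= s by near: s; exact: nbhs_pinfty_ge.
have s0 : 0 < s by apply: lt_le_trans sm; rewrite mulr_gt0// ltr0n.
have mE : measurable (checker_complement R d.+1 m `&` cube s).
  by apply: measurableI; [exact: measurable_checker_complement|exact: measurable_cube].
rewrite lebesgueE//.
have /andP[lo hi] := checker_complement_cube_bounds d m0 sm.
have sd0 : 0 < s ^+ d by rewrite exprn_gt0.
have V0 : (0 <= ((s ^+ d.+1)^-1)%:E)%E by rewrite lee_fin invr_ge0 exprn_ge0// ltW.
have divE C : (delta * s + C) * s ^+ d * (s ^+ d.+1)^-1 = delta + C * s^-1.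
  by rewrite exprS; field; rewrite !lt0r_neq0.
apply/andP; split.
  by apply: le_trans (lee_wpmul2r V0 lo); rewrite -EFinM divE.
by apply: le_trans (lee_wpmul2r V0 hi) _; rewrite -EFinM divE.
Unshelve. all: by end_near.
Qed.

(** * The theorem *)

Theorem theorem3 (R : realType) (d : nat) (hd : (1 <= d)%N)
    (p : R) (hp1 : 1 < p) (hp2 : p != 2)
    (n : nat) (hn : (2 * d + 1 <= n)%N) :
  exists (E P : set (pointR R d)) (r : nat -> R),
    [/\ lebesgue_measurable E,
        (P #= `I_n)%card,
        (forall j, 0 < r j) /\ r @ \oo --> +oo,
        forall j, ~ contains_lp_copy p (r j) P E
      & has_density E (1 - (n%:R - (2 * d)%:R + 2)^-1)].
Proof.
case: d hd hn => // d _ hn.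
(* With d.+1 in place of d, this is n - 2 d.+1 + 2. *)
pose m := (n - 2 * d)%N.
have m3 : (3 <= m)%N by rewrite /m; lia.
have mR : n%:R - (2 * d.+1)%:R + 2 = m%:R :> R.
  have -> : n = (m + 2 * d)%N by rewrite /m; lia.
  by rewrite mulnS !natrD; ring.
exists (checker_complement R d.+1 m), (configuration R d m),
  (fun j => (j * m + 1)%:R).
split.
- by apply: lebesgue_measurableW; exact: measurable_checker_complement.
- have -> : n = (m + d * 2)%N by rewrite /m; lia.
  exact: card_configuration.
- split => [j|]; first by rewrite ltr0n addn1.
  by apply: ger_cvgy cvgr_idn; apply: nearW => j; rewrite ler_nat; nia.
- by move=> j; exact: no_copy.
- by rewrite mR; apply: has_density_checker_complement; lia.
Qed.
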